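(* There exists a triple of positive integers $\mathbf{t}=(d,D,m)$ such that $$R_{3}^{\mathbf{t}}(4,n)>n^{(\log n)^{1/3-o(1)}},$$ where $o(1)$ denotes a quantity tending to $0$ as $n\to\infty$.
   Context: An $r$-uniform hypergraph $H$ is semi-algebraic of complexity $\mathbf{t}=(d,D,m)$ if there is an enumeration $v_1,\dots,v_N$ of its vertices, an assignment $v_i\mapsto p_i\in\mathbb{R}^d$ for $i\in[N]=\{1,\dots,N\}$, $m$ polynomials $f_1,\dots,f_m:(\mathbb{R}^d)^r\to\mathbb{R}$ of (total) degree at most $D$, and a function $\Phi:\{+,-,0\}^m\to\{\text{True},\text{False}\}$ such that for all $1\le i_1<\dots<i_r\le N$, the set $\{v_{i_1},\dots,v_{i_r}\}$ is an edge of $H$ if and only if $\Phi(\operatorname{sign}f_1(p_{i_1},\dots,p_{i_r}),\dots,\operatorname{sign}f_m(p_{i_1},\dots,p_{i_r}))=\text{True}$, where $\operatorname{sign}(x)\in\{+,-,0\}$ is the sign of $x$. The semi-algebraic Ramsey number $R_r^{\mathbf{t}}(s,n)$ is the smallest $N$ such that every $r$-uniform semi-algebraic hypergraph of complexity $\mathbf{t}$ on $N$ vertices contains either a clique of size $s$ (a set of $s$ vertices all of whose $r$-element subsets are edges) or an independent set of size $n$ (a set of $n$ vertices none of whose $r$-element subsets is an edge). *)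

(* Defs.v *)
From mathcomp Require Import all_boot all_order all_algebra.
From mathcomp Require Import all_classical all_reals all_analysis.
(* The notations of mpoly clash with those of MathComp-Analysis. *)
From mathcomp Require Import (canonicals, coercions) mpoly.

Set Implicit Arguments.
Unset Strict Implicit.
Unset Printing Implicit Defensive.

Import Order.TTheory GRing.Theory Num.Theory.

Local Open Scope ring_scope.

Definition uniform_hypergraph (V : finType) (r : nat) (H : {set {set V}}) : Prop :=
  forall e : {set V}, e \in H -> #|e| = r.

Inductive sign : Set := Neg | Zero | Pos.

Definition sign_of (R : realType) (x : R) : sign :=
  if x < 0 then Neg else if x == 0 then Zero else Pos.

(* A point of (R^d)^r is an r x d matrix whose rows are its r components; it is
   flattened by [mxvec] so as to be plugged into a polynomial in r * d
   variables. *)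
Definition eval_points (R : realType) (r d : nat)
    (f : mpoly.mpoly (r * d) R) (p : 'I_r -> 'rV[R]_d) : R :=
  mpoly.meval (fun k => mxvec (\matrix_(j < r) p j) 0 k) f.

(* [mmeasure mdeg f] is 1 + the total degree of f (and 0 when f = 0). *)
Definition total_degree_le (R : realType) (k D : nat) (f : mpoly.mpoly k R) : Prop :=
  (mpoly.mmeasure (@mpoly.mdeg k) f <= D.+1)%N.

Definition semialgebraic (R : realType) (d D m : nat)
    (V : finType) (r : nat) (H : {set {set V}}) : Prop :=
  exists v : 'I_#|V| -> V,
  exists p : 'I_#|V| -> 'rV[R]_d,
  exists f : 'I_m -> mpoly.mpoly (r * d) R,
  exists Phi : ('I_m -> sign) -> bool,
    [/\ bijective v,
        forall k : 'I_m, total_degree_le D (f k) &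
        forall i : 'I_r -> 'I_#|V|,
          {homo i : j k / (j < k)%N} ->
          ([set v (i j) | j : 'I_r] \in H)
            = Phi (fun k => sign_of (eval_points (f k) (fun j => p (i j))))].

Definition is_clique (V : finType) (r : nat) (H : {set {set V}}) (S : {set V}) : Prop :=
  forall e : {set V}, e \subset S -> #|e| = r -> e \in H.

Definition is_independent (V : finType) (r : nat) (H : {set {set V}}) (S : {set V}) : Prop :=
  forall e : {set V}, e \subset S -> #|e| = r -> e \notin H.

Definition semialg_ramsey_prop (R : realType) (d D m r s n N : nat) : Prop :=
  forall (V : finType) (H : {set {set V}}),
    #|V| = N -> uniform_hypergraph r H -> semialgebraic R d D m r H ->
    (exists S : {set V}, #|S| = s /\ is_clique r H S) \/
    (exists S : {set V}, #|S| = n /\ is_independent r H S).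

(* Ramsey's theorem, relative to a subset A of the vertices and for arbitrary
   two-colorings c of all subsets (only the r-subsets matter). *)
Lemma ramsey_finite (r s n : nat) :
  exists N : nat, forall (V : finType) (A : {set V}) (c : {set V} -> bool),
    (N <= #|A|)%N ->
    (exists S : {set V}, [/\ S \subset A, #|S| = s &
       forall e : {set V}, e \subset S -> #|e| = r -> c e]) \/
    (exists S : {set V}, [/\ S \subset A, #|S| = n &
       forall e : {set V}, e \subset S -> #|e| = r -> ~~ c e]).
Proof.
elim: r s n => [|r IHr] s n.
  exists (maxn s n) => V A c; rewrite geq_max => /andP[sA nA].
  have sub k : (k <= #|A|)%N -> exists S : {set V}, S \subset A /\ #|S| = k.
    move=> kA; have := bin_gt0 #|A| k; rewrite kA -cards_draws card_gt0.
    by case/set0Pn => S; rewrite inE => /andP[SA /eqP Sk]; exists S.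
  case c0: (c (@finset.set0 V)).
    left; have [S [SA Sk]] := sub s sA; exists S; split=> // e _ /eqP.
    by rewrite cards_eq0 => /eqP ->; rewrite c0.
  right; have [S [SA Sk]] := sub n nA; exists S; split=> // e _ /eqP.
  by rewrite cards_eq0 => /eqP ->; rewrite c0.
elim: s n => [|s IHs] n.
  exists 0%N => V A c _; left; exists (@finset.set0 V).
  split; rewrite ?finset.sub0set ?cards0 // => e.
  by rewrite finset.subset0 => /eqP ->; rewrite cards0.
elim: n => [|n [Nr HNr]].
  exists 0%N => V A c _; right; exists (@finset.set0 V).
  split; rewrite ?finset.sub0set ?cards0 // => e.
  by rewrite finset.subset0 => /eqP ->; rewrite cards0.
have [Nl HNl] := IHs n.+1.
have [M HM] := IHr Nl Nr.
exists M.+1 => V A c AM.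
have /card_gt0P[x xA] : (0 < #|A|)%N by apply: leq_trans AM.
have AxM : (M <= #|A :\ x|)%N by move: AM; rewrite (cardsD1 x A) xA.
have link (b : bool) (S T : {set V}) :
    S \subset A :\ x -> T \subset S ->
    (forall e : {set V}, e \subset S -> #|e| = r -> c (x |: e) = b) ->
    (forall e : {set V}, e \subset T -> #|e| = r.+1 -> c e = b) ->
    [/\ x |: T \subset A, #|x |: T| = #|T|.+1 &
        forall e : {set V}, e \subset x |: T -> #|e| = r.+1 -> c e = b].
  move=> SA TS cS cT; have TA := fintype.subset_trans TS SA; split.
  - rewrite finset.subUset finset.sub1set xA /=.
    by apply: (fintype.subset_trans TA); apply: finset.subsetDl.
  - rewrite cardsU1; suff -> : x \notin T by [].
    by apply/negP => /(fintype.subsetP TA); rewrite !inE eqxx.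
  move=> e eT er; have [xe|xe] := boolP (x \in e).
    rewrite -(finset.setD1K xe); apply: cS.
      by apply: fintype.subset_trans TS; rewrite finset.subDset.
    by move: er; rewrite (cardsD1 x e) xe => -[].
  apply: cT => //; apply/fintype.subsetP => y ye.
  have := fintype.subsetP eT y ye; rewrite !inE => /orP[/eqP yx|//].
  by rewrite -yx ye in xe.
have [[S [SA SN cS]]|[S [SA SN cS]]] := HM V (A :\ x) (fun e => c (x |: e)) AxM.
  have SA' : S \subset A by apply: (fintype.subset_trans SA); apply: finset.subsetDl.
  have [|[T [TS Ts cT]]|[T [TS Tn cT]]] := HNl V S c; first by rewrite SN.
    left; have [] := link true S T SA TS cS cT.
    by rewrite Ts => *; exists (x |: T).
  by right; exists T; split=> //; apply: fintype.subset_trans SA'.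
have SA' : S \subset A by apply: (fintype.subset_trans SA); apply: finset.subsetDl.
have [|[T [TS Ts cT]]|[T [TS Tn cT]]] := HNr V S c; first by rewrite SN.
  by left; exists T; split=> //; apply: fintype.subset_trans SA'.
right; have [||xTA xTn cxT] := link false S T SA TS.
- by move=> e eS er; apply/negbTE/cS.
- by move=> e eT er; apply/negbTE/cT.
by exists (x |: T); split; rewrite ?xTn ?Tn // => e eT er; rewrite cxT.
Qed.

Lemma semialg_ramsey_exists (R : realType) (d D m r s n : nat) :
  exists N : nat, `[< semialg_ramsey_prop R d D m r s n N >].
Proof.
have [N HN] := ramsey_finite r s n.
exists N; apply/asboolP => V H VN _ _.
have [|[S [_ Sk HS]]|[S [_ Sk HS]]] := HN V [set: V] (fun e => e \in H).
- by rewrite finset.cardsT VN.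
- by left; exists S.
- by right; exists S.
Qed.

Definition semialg_ramsey (R : realType) (d D m r s n : nat) : nat :=
  ex_minn (semialg_ramsey_exists R d D m r s n).

(* Main.v *)
(* Flags (p, l) of a k x 2k^2 grid of points and k^3 lines, with (p, l) joined
   to (p', l') when p' lies on l to the right of p and l' is steeper than l, form
   a graph E on k^4 vertices. It is triangle-free, since two lines share at most
   one point. In an independent set, every flag either has the steepest line
   through its point or the leftmost point on its line, so independent sets have
   at most 3k^3 elements.

   Index the flags by the positions 0, ..., k^4 - 1 of binary digits and call
   x < y < z < 2^(k^4) an edge when the top differing positions of (x, y) and of
   (y, z) are adjacent. A clique on four vertices would give a triangle of E. An
   independent set S injects into the independent sets of E, by sending x to its
   top differing positions with larger elements of S; hence |S| is at most
   (k^4 + 1)^(3k^3). So log N is about k^4 while log n is about k^3 log k.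

   The hypergraph is semi-algebraic: map x to the sum of B^i (1, a_i, u_i, v_i)
   over its nonzero digits i. For B large, the quotients of the coordinates of a
   difference approximate the flag at the top differing position, and integrality
   makes the adjacency of two flags an open condition on these quotients. *)
Require Import Defs.
From mathcomp Require Import all_boot all_order all_algebra.
From mathcomp Require Import zify ring lra.

Set Implicit Arguments.
Unset Strict Implicit.
Unset Printing Implicit Defensive.

(** * The graph of flags *)

(* For i < k ^ 4, the point (a, u a + v) on the line Y = u X + v, where a, u < k
   and v < k ^ 2 are the abscissa, slope and intercept encoded by i. *)
Definition abscissa (k i : nat) : nat := i %/ k ^ 3.
Definition slope (k i : nat) : nat := i %/ k ^ 2 %% k.
Definition intercept (k i : nat) : nat := i %% k ^ 2.

Definition flag_adj (k i j : nat) : bool :=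
  [&& abscissa k i < abscissa k j, slope k i < slope k j &
      slope k j * abscissa k j + intercept k j
        == slope k i * abscissa k j + intercept k i].

(** The abscissa is the leading digit of the code of a flag, so adjacency increases the code.
    Stepping up relies on this order. *)
Lemma flag_adj_lt k i j : flag_adj k i j -> i < j.
Proof.
case/and3P => aij _ _; rewrite ltnNge; apply: contraL aij => ji.
by rewrite -leqNgt leq_div2r.
Qed.

(* Two lines meet in at most one point. *)
Lemma flag_adj_triangle_free k i j l :
  flag_adj k i j -> flag_adj k j l -> flag_adj k i l -> False.
Proof.
rewrite /flag_adj => /and3P[aij uij /eqP eij] /and3P[ajl ujl /eqP ejl].
(* The points of [j] and [l], of different abscissae, would both lie on the lines of [i] and [j],
   whose slopes differ. *)
by case/and3P => ail uil /eqP eil; nia.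
Qed.

Lemma flag_inj k i j : abscissa k i = abscissa k j -> slope k i = slope k j ->
  intercept k i = intercept k j -> i = j.
Proof.
rewrite /abscissa /slope /intercept => ha hu hv.
rewrite (divn_eq i (k ^ 2)) (divn_eq j (k ^ 2)) hv.
rewrite (divn_eq (i %/ k ^ 2) k) (divn_eq (j %/ k ^ 2) k) hu.
by rewrite -!divnMA -!expnSr ha.
Qed.

Lemma abscissa_lt k i : i < k ^ 4 -> abscissa k i < k.
Proof.
case: k => [|k] // h.
by rewrite /abscissa ltn_divLR ?expn_gt0 // mulnC -expnSr.
Qed.

Lemma slope_lt k i : 0 < k -> slope k i < k.
Proof. exact: ltn_pmod. Qed.

Lemma intercept_lt k i : 0 < k -> intercept k i < k ^ 2.
Proof. by move=> k0; rewrite ltn_pmod // expn_gt0 k0. Qed.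

(** Flags whose line is the steepest in [I] through their point inject into the [2 * k ^ 3] points;
    the other flags of [I] inject into the [k ^ 3] lines. *)
Lemma flag_independent_card k (I : {set 'I_(k ^ 4)}) : 0 < k ->
  {in I &, forall i j : 'I_(k ^ 4), ~~ flag_adj k i j} -> #|I| <= 3 * k ^ 3.
Proof.
move=> k0 indI.
have pt_lt (i : 'I_(k ^ 4)) :
    slope k i * abscissa k i + intercept k i < 2 * k ^ 2.
  have := abscissa_lt (ltn_ord i); have := slope_lt i k0.
  by have := intercept_lt i k0; nia.
pose pt (i : 'I_(k ^ 4)) : 'I_k * 'I_(2 * k ^ 2) :=
  (Ordinal (abscissa_lt (ltn_ord i)), Ordinal (pt_lt i)).
pose ln (i : 'I_(k ^ 4)) : 'I_k * 'I_(k ^ 2) :=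
  (Ordinal (slope_lt i k0), Ordinal (intercept_lt i k0)).
pose steepest := [set i in I | [forall j in I, (pt j == pt i) ==> (slope k j <= slope k i)]].
have ptP i j : pt i = pt j -> abscissa k i = abscissa k j /\
    slope k i * abscissa k i + intercept k i = slope k j * abscissa k j + intercept k j.
  by case.
have lnP i j : ln i = ln j -> slope k i = slope k j /\ intercept k i = intercept k j.
  by case.
have pt_inj : {in steepest &, injective pt}.
  move=> i j; rewrite !inE => /andP[iI /forall_inP iM] /andP[jI /forall_inP jM] eij.
  have := iM j jI; have := jM i iI; rewrite eij eqxx /= => uij uji.
  have /eqP u : slope k i == slope k j by rewrite eqn_leq uij uji.
  have [a] := ptP _ _ eij; rewrite a u => /addnI v.
  by apply/val_inj/(@flag_inj k).
have ln_inj : {in I :\: steepest &, injective ln}.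
  suff aux i j : i \in I :\: steepest -> j \in I :\: steepest -> ln i = ln j ->
      abscissa k i < abscissa k j -> False.
    move=> i j iI jI eij; have [u v] := lnP _ _ eij.
    case: (ltngtP (abscissa k i) (abscissa k j)) => a.
    - by case: (aux i j).
    - by case: (aux j i).
    - by apply/val_inj/(@flag_inj k).
  rewrite !inE => /andP[_ iI] /andP[+ jI] /lnP[u v] a; rewrite jI /=.
  (* [l] has the point of [j] and a steeper line. Since [i] lies on the line of [j], further left,
     [i] is adjacent to [l]. *)
  case/forall_inPn => l lI; rewrite negb_imply -ltnNge => /andP[/eqP/ptP[al el] ul].
  have /negP := indI i l iI lI; apply; rewrite /flag_adj al a u ul /=.
  by rewrite -al el al v.
have -> : #|I| = #|steepest| + #|I :\: steepest|.
  rewrite -(cardsID steepest I) (setIidPr _) //.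
  by apply/subsetP => i; rewrite inE => /andP[].
rewrite (_ : 3 * k ^ 3 = k * (2 * k ^ 2) + k * k ^ 2); last by rewrite !expnS; lia.
rewrite -(card_in_imset pt_inj) -(card_in_imset ln_inj) leq_add //.
  by apply: leq_trans (max_card _) _; rewrite card_prod !card_ord.
by apply: leq_trans (max_card _) _; rewrite card_prod !card_ord.
Qed.

(** * Stepping up to a 3-uniform hypergraph *)

(** The enumeration of a small set, padded with [None], is a word of length [m] over [#|T|.+1]
    letters. *)
Lemma card_small_sets (T : finType) (m : nat) :
  #|[set A : {set T} | #|A| <= m]| <= #|T|.+1 ^ m.
Proof.
pose code (A : {set T}) : {ffun 'I_m -> option T} :=
  [ffun j : 'I_m => nth None (map Some (enum A)) j].
have code_inj : {in [set A : {set T} | #|A| <= m] &, injective code}.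
  suff aux (A B : {set T}) : #|A| <= m -> code A = code B -> A \subset B.
    move=> A B; rewrite !inE => Am Bm AB; apply/eqP.
    by rewrite eqEsubset !aux.
  move=> Am /ffunP AB; apply/subsetP => x xA.
  have xs : index x (enum A) < size (enum A) by rewrite index_mem mem_enum.
  have xm : index x (enum A) < m by apply: leq_trans xs _; rewrite -cardE.
  have := AB (Ordinal xm); rewrite !ffunE /= (nth_map x) // nth_index ?mem_enum //.
  case: (ltnP (index x (enum A)) (size (enum B))) => xB.
    by rewrite (nth_map x) // => -[->]; rewrite -(mem_enum B) mem_nth.
  by rewrite nth_default // size_map.
rewrite -(card_in_imset code_inj); apply: leq_trans (max_card _) _.
by rewrite card_ffun card_option card_ord.
Qed.

(* i is the most significant position at which the binary digits of x < y
   differ. *)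
Definition top_bit (i x y : nat) : bool :=
  [&& x %/ 2 ^ i.+1 == y %/ 2 ^ i.+1, ~~ odd (x %/ 2 ^ i) & odd (y %/ 2 ^ i)].

Lemma divn_exp2_eq i j x y : i <= j -> x %/ 2 ^ i = y %/ 2 ^ i ->
  x %/ 2 ^ j = y %/ 2 ^ j.
Proof. by move=> /subnKC <- h; rewrite expnD !divnMA h. Qed.

Lemma top_bit_lt i x y : top_bit i x y -> x < y.
Proof.
case/and3P => /eqP; rewrite expnSr !divnMA !divn2 => h xo yo.
rewrite ltnNge; apply/negP => /(leq_div2r (2 ^ i)).
rewrite -(odd_double_half (x %/ _)) -(odd_double_half (y %/ _)) h yo (negbTE xo).
by lia.
Qed.

Lemma half_eq_odd (a b : nat) : a <= b -> a != b -> a./2 = b./2 -> ~~ odd a && odd b.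
Proof.
move=> ab ne h; move: ab ne; rewrite -(odd_double_half a) -(odd_double_half b) h.
by rewrite !oddD !odd_double !addbF; case: (odd a); case: (odd b) => //=;
  rewrite ?leq_add2r ?eqxx.
Qed.

Lemma top_bit_exists M x y : x < y -> y < 2 ^ M -> exists i : 'I_M, top_bit i x y.
Proof.
move=> xy yM.
have xM := ltn_trans xy yM.
have ex : exists i, x %/ 2 ^ i == y %/ 2 ^ i by exists M; rewrite !divn_small.
(* The least shift that equates [x] and [y] is positive; its predecessor is the position sought. *)
case: (ex_minnP ex) => -[|i] hi imin.
  by move: hi xy; rewrite !divn1 => /eqP ->; rewrite ltnn.
have iM : i < M by apply: imin; rewrite !divn_small.
exists (Ordinal iM); rewrite /top_bit hi /=.
have ne : x %/ 2 ^ i != y %/ 2 ^ i by apply/negP => /imin; rewrite ltnn.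
have := leq_div2r (2 ^ i) (ltnW xy).
move=> le; apply: half_eq_odd le ne _.
by move/eqP: hi; rewrite expnSr !divnMA !divn2.
Qed.

Lemma top_bit_inj i j x y : top_bit i x y -> top_bit j x y -> i = j.
Proof.
suff aux i' j' : top_bit i' x y -> top_bit j' x y -> ~~ (i' < j').
  move=> hi hj; have := aux _ _ hi hj; have := aux _ _ hj hi.
by case: ltngtP.
case/and3P => /eqP hi _ _ /and3P[_ xo yo]; apply/negP => ij.
by move: xo; rewrite (divn_exp2_eq ij hi) yo.
Qed.

(** [x] and [y] have the same digits above [i], hence from [j] on, so they are interchangeable in
    [top_bit j]. *)
Lemma top_bit_trans i j x y z : i < j -> top_bit i x y ->
  top_bit j y z = top_bit j x z.
Proof.
move=> ij /and3P[/eqP hi _ _]; rewrite /top_bit.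
by rewrite (divn_exp2_eq ij hi) (divn_exp2_eq (leq_trans ij (leqnSn j)) hi).
Qed.

Lemma cards3_lt N (x y z : 'I_N) : x < y -> y < z -> #|[set x; y; z]| = 3.
Proof.
move=> xy yz; have xz := ltn_trans xy yz.
rewrite -finset.setUA cardsU1 cards2 !inE negb_or -!val_eqE /=.
by rewrite (ltn_eqF xy) (ltn_eqF yz) (ltn_eqF xz).
Qed.

Section StepUp.
Variables (M : nat) (E : rel nat).
Hypothesis E_lt : forall i j, E i j -> i < j.

Definition step_up_triple (x y z : nat) : bool :=
  [exists i : 'I_M, exists j : 'I_M, [&& top_bit i x y, top_bit j y z & E i j]].

(** A set carries no order, so all triples of elements are quantified over and the increasing one is
    tested. *)
Definition step_up (N : nat) : {set {set 'I_N}} :=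
  [set e : {set 'I_N} | (#|e| == 3) &&
     [forall x in e, forall y in e, forall z in e,
        (x < y < z) ==> step_up_triple x y z]].

Lemma step_up_uniform N : uniform_hypergraph 3 (step_up N).
Proof. by move=> e; rewrite inE => /andP[/eqP]. Qed.

Lemma step_upE N (x y z : 'I_N) : x < y -> y < z ->
  ([set x; y; z] \in step_up N) = step_up_triple x y z.
Proof.
move=> xy yz; have xz := ltn_trans xy yz.
rewrite inE (cards3_lt xy yz) eqxx andTb.
apply/idP/idP.
  have [xS yS zS] : [/\ x \in [set x; y; z], y \in [set x; y; z] & z \in [set x; y; z]].
    by rewrite !inE !eqxx !orbT.
  move=> /forall_inP h; have /forall_inP h' := h x xS.
  have /forall_inP/(_ z zS) := h' y yS.
  by rewrite xy yz.
move=> T; apply/forall_inP => a; rewrite !inE => ha.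
apply/forall_inP => b; rewrite !inE => hb; apply/forall_inP => c; rewrite !inE => hc.
apply/implyP => /andP[]; move: T xy yz xz.
case/orP: ha => [/orP[]|] /eqP->; case/orP: hb => [/orP[]|] /eqP->;
  case/orP: hc => [/orP[]|] /eqP->; by [|lia].
Qed.

Lemma step_up_tripleP x y z i j : i < M -> j < M ->
  top_bit i x y -> top_bit j y z -> step_up_triple x y z = E i j.
Proof.
move=> iM jM hi hj; apply/idP/idP.
  case/existsP => i' /existsP[j' /and3P[hi' hj' Eij]].
  by rewrite (top_bit_inj hi hi') (top_bit_inj hj hj').
by move=> Eij; apply/existsP; exists (Ordinal iM);
  apply/existsP; exists (Ordinal jM); apply/and3P.
Qed.

(** For [w < x < y < z] with consecutive top differing positions [i], [j], [l], the edges [wxy] and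
    [xyz] give [E i j] and [E j l]. As [j < l], the pair [x], [z] has top position [l], so [wxz]
    gives [E i l]. *)
Lemma step_up_K4_free N (S : {set 'I_N}) :
  (forall i j l, E i j -> E j l -> E i l -> False) ->
  #|S| = 4 -> is_clique 3 (step_up N) S -> False.
Proof.
move=> trf S4 clS.
pose s := [seq val x | x <- enum S].
have s_sorted : sorted ltn s.
  apply: (subseq_sorted ltn_trans _ (iota_ltn_sorted 0 N)).
  by rewrite -val_enum_ord map_subseq // [in X in subseq _ X]enumT filter_subseq.
have sS : size s = 4 by rewrite size_map -cardE.
case es: (enum S) => [|w [|x [|y [|z [|? ?]]]]];
  try by move: sS; rewrite /s es.
move: s_sorted; rewrite /s es /= => /and4P[wx xy yz _].
have sub a b c : a \in enum S -> b \in enum S -> c \in enum S -> a < b -> b < c ->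
    step_up_triple a b c.
  rewrite !mem_enum => aS bS cS ab bc; rewrite -step_upE //; apply: clS.
    by rewrite !finset.subUset !finset.sub1set aS bS cS.
  exact: cards3_lt.
have Twxy : step_up_triple w x y by apply: sub; rewrite // es !inE eqxx ?orbT.
have Txyz : step_up_triple x y z by apply: sub; rewrite // es !inE eqxx ?orbT.
have Twxz : step_up_triple w x z.
  by apply: sub; rewrite ?es ?inE ?eqxx ?orbT // (ltn_trans xy yz).
case/existsP: Twxy => i /existsP[j /and3P[hi hj Eij]].
case/existsP: Txyz => j' /existsP[l /and3P[hj' hl]].
rewrite -(top_bit_inj hj hj') => Ejl.
have hl' : top_bit l x z by rewrite -(top_bit_trans _ (E_lt Ejl) hj).
move: Twxz; rewrite (step_up_tripleP (ltn_ord i) (ltn_ord l) hi hl').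
exact: trf Eij Ejl.
Qed.

(* The set of positions top_bit i x y, for y > x in the independent set S, is
   E-independent and determines x. *)
Lemma step_up_independent_card N (S : {set 'I_N}) (m : nat) : N <= 2 ^ M ->
  (forall I : {set 'I_M}, {in I &, forall i j : 'I_M, ~~ E i j} -> #|I| <= m) ->
  is_independent 3 (step_up N) S -> #|S| <= M.+1 ^ m.
Proof.
move=> NM Em indS.
pose L (x : 'I_N) := [set i : 'I_M | [exists y in S, top_bit i x y]].
have L_inj : {in S &, injective L}.
  suff aux x y : y \in S -> L x = L y -> ~~ (x < y).
    move=> x y xS yS e; apply: val_inj.
    have := aux _ _ yS e; have := aux _ _ xS (esym e).
    by rewrite -!leqNgt => xy yx; apply/eqP; rewrite eqn_leq xy yx.
  move=> yS e; apply/negP => xy.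
  (* The digit of [y] at [i] is 1, but [i] in [L y] would make it 0. *)
  have [i hi] := top_bit_exists xy (leq_trans (ltn_ord y) NM).
  have : i \in L x by rewrite inE; apply/exists_inP; exists y.
  rewrite e inE => /exists_inP[z zS].
  by case/and3P: hi => _ _ yo /and3P[_]; rewrite yo.
rewrite -(card_in_imset L_inj).
have := @card_small_sets ('I_M : finType) m; rewrite card_ord; apply: leq_trans.
apply/subset_leq_card/subsetP => _ /imsetP[x xS ->]; rewrite inE; apply: Em.
move=> i j; rewrite !inE => /exists_inP[y yS hi] /exists_inP[z zS hj].
(* As [i < j], the pair [y], [z] also has top position [j], so [x], [y], [z] would form an edge
   inside [S]. *)
apply/negP => Eij; have ij := E_lt Eij.
have hj' : top_bit j y z by rewrite (top_bit_trans _ ij hi).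
have xy := top_bit_lt hi; have yz := top_bit_lt hj'.
suff : [set x; y; z] \notin step_up N.
  by rewrite step_upE // (step_up_tripleP _ _ hi hj') // Eij.
apply: indS; first by rewrite !finset.subUset !finset.sub1set xS yS zS.
exact: cards3_lt.
Qed.

End StepUp.

(** * Semi-algebraic realization *)

Import Order.TTheory GRing.Theory Num.Theory.
Local Open Scope ring_scope.

Definition bitsum (R : pzSemiRingType) (B : R) (M : nat) (w : nat -> R) (x : nat) : R :=
  \sum_(i < M) (odd (x %/ 2 ^ i))%:R * B ^+ i * w i.

Lemma bitsum_linear (R : comPzRingType) (B c : R) M (w : nat -> R) x :
  bitsum B M (fun i => w i - c) x = bitsum B M w x - c * bitsum B M (fun=> 1) x.
Proof.
rewrite /bitsum mulr_sumr -sumrB; apply: eq_bigr => i _; ring.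
Qed.

Lemma bitsum_top_bit_sub (R : comPzRingType) (B : R) M (w : nat -> R) d x y :
  (d < M)%N -> top_bit d x y ->
  bitsum B M w y - bitsum B M w x = B ^+ d * w d +
    \sum_(i < d) ((odd (y %/ 2 ^ i))%:R - (odd (x %/ 2 ^ i))%:R) * B ^+ i * w i.
Proof.
move=> dM /and3P[/eqP hd xd yd].
pose F i := ((odd (y %/ 2 ^ i))%:R - (odd (x %/ 2 ^ i))%:R) * B ^+ i * w i.
have -> : bitsum B M w y - bitsum B M w x = \sum_(0 <= i < M) F i.
  by rewrite big_mkord /bitsum -sumrB; apply: eq_bigr => i _; rewrite /F; ring.
rewrite (big_cat_nat (n := d.+1)) //= big_nat_recr //= big_mkord.
rewrite [X in _ + X]big1_seq ?addr0 => [|i /andP[_]]; last first.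
  rewrite mem_index_iota => /andP[di _].
  by rewrite /F (divn_exp2_eq di hd) subrr !mul0r.
by rewrite addrC {1}/F yd (negbTE xd) subr0 mul1r.
Qed.

(** Let [S] be the sum of [B ^+ i] over [i < d]. Recentering the weights at [w d] cancels the
    leading term, so the error is at most [S * W], while the denominator is at least
    [B ^+ d - S = (B - 2) * S + 1]. *)
Lemma bitsum_top_bit_approx (R : realFieldType) (B W K : R) M (w : nat -> R) d x y :
  0 <= W -> 0 <= K -> K * W + 2 <= B ->
  (d < M)%N -> top_bit d x y -> (forall i, (i < M)%N -> `|w i - w d| <= W) ->
  let D u := bitsum B M u y - bitsum B M u x in
  0 < D (fun=> 1) /\ K * `|D w - w d * D (fun=> 1)| <= D (fun=> 1).
Proof.
move=> W0 K0 BK dM hd wW D.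
have B0 : 0 <= B by nra.
set S := \sum_(i < d) B ^+ i.
have S0 : 0 <= S by apply: sumr_ge0 => i _; rewrite exprn_ge0.
have SB : (B - 1) * S = B ^+ d - 1 by rewrite subrX1.
have bound V (u : nat -> R) : (forall i, (i < M)%N -> `|u i| <= V) ->
    `|\sum_(i < d) ((odd (y %/ 2 ^ i))%:R - (odd (x %/ 2 ^ i))%:R) * B ^+ i * u i| <= S * V.
  move=> uV; rewrite mulr_suml; apply: le_trans (ler_norm_sum _ _ _) _.
  apply: ler_sum => i _; rewrite !normrM [`|B ^+ i|]ger0_norm ?exprn_ge0 //.
  rewrite ler_pM ?mulr_ge0 ?exprn_ge0 //; last by apply/uV/(ltn_trans (ltn_ord i)).
  rewrite ler_piMl ?exprn_ge0 //.
  by do 2!case: odd; rewrite ?subrr ?subr0 ?sub0r ?normrN ?normr0 ?normr1.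
have D1 : B ^+ d - S <= D (fun=> 1).
  rewrite /D (bitsum_top_bit_sub _ _ dM hd) mulr1 lerD2l.
  have := bound 1 (fun=> 1); rewrite normr1 => /(_ (fun _ _ => lexx _)).
  by rewrite ler_norml mulr1 => /andP[].
have D1W : K * W * S + 1 <= D (fun=> 1).
  have : (K * W + 2) * S <= B * S by apply: ler_wpM2r.
  by move: SB D1; rewrite !mulrBl mul1r mulrDl; lra.
have KWS : 0 <= K * W * S by rewrite !mulr_ge0.
split; first by lra.
have -> : D w - w d * D (fun=> 1) =
    \sum_(i < d) ((odd (y %/ 2 ^ i))%:R - (odd (x %/ 2 ^ i))%:R) * B ^+ i * (w i - w d).
  have := bitsum_top_bit_sub B (fun i => w i - w d) dM hd.
  by rewrite !bitsum_linear /D subrr mulr0 add0r => <-; ring.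
have /(ler_wpM2l K0) := bound W _ wW; rewrite mulrA mulrAC; lra.
Qed.

(* With s_c, t_c the coordinates of the differences of consecutive points, the
   ratios s_c / s_0 and t_c / t_0 approximate the abscissa, slope and intercept
   (c = 1, 2, 3) of two flags, and these three polynomials are all positive if
   and only if the flags are adjacent. *)
Definition flag_polys (A : comPzRingType) (s0 s1 s2 s3 t0 t1 t2 t3 : A) : seq A :=
  [:: (t1 * s0 - s1 * t0) *+ 2 - s0 * t0;
      (t2 * s0 - s2 * t0) *+ 2 - s0 * t0;
      (s0 * t0 ^+ 2) ^+ 2
        - ((t2 * s0 - s2 * t0) * t1 + (t3 * s0 - s3 * t0) * t0) ^+ 2 *+ 4].

(** Up to positive factors, the tests compare differences of near-integers with [1/2]; errors of at
    most [1/4] cannot change the outcome. *)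
Lemma flag_polys_gt0 (R : realFieldType) (k i j : nat)
    (s0 s1 s2 s3 t0 t1 t2 t3 : R) :
  (0 < k)%N -> (abscissa k i < k)%N -> (abscissa k j < k)%N ->
  let K := (12 * k + 16)%:R in
  0 < s0 -> 0 < t0 ->
  K * `|s1 - (abscissa k i)%:R * s0| <= s0 ->
  K * `|s2 - (slope k i)%:R * s0| <= s0 ->
  K * `|s3 - (intercept k i)%:R * s0| <= s0 ->
  K * `|t1 - (abscissa k j)%:R * t0| <= t0 ->
  K * `|t2 - (slope k j)%:R * t0| <= t0 ->
  K * `|t3 - (intercept k j)%:R * t0| <= t0 ->
  all (fun c => 0 < c) (flag_polys s0 s1 s2 s3 t0 t1 t2 t3) = flag_adj k i j.
Proof.
move=> k0 ai aj K s0_gt0 t0_gt0.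
have K0 : 0 < K by rewrite ltr0n addn_gt0 orbT.
have quot (c c0 : R) (n : nat) : 0 < c0 -> K * `|c - n%:R * c0| <= c0 ->
    exists q, c = q * c0 /\ K * `|q - n%:R| <= 1.
  move=> c0_gt0 h; exists (c / c0); split; first by rewrite divfK ?gt_eqF.
  rewrite -(ler_pM2r c0_gt0) mul1r -mulrA -{2}(gtr0_norm c0_gt0) -normrM mulrBl.
  by rewrite divfK ?gt_eqF.
move=> /(quot _ _ _ s0_gt0)[p1 [-> hp1]] /(quot _ _ _ s0_gt0)[p2 [-> hp2]].
move=> /(quot _ _ _ s0_gt0)[p3 [-> hp3]] /(quot _ _ _ t0_gt0)[q1 [-> hq1]].
move=> /(quot _ _ _ t0_gt0)[q2 [-> hq2]] /(quot _ _ _ t0_gt0)[q3 [-> hq3]].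
have st_gt0 : 0 < s0 * t0 by rewrite mulr_gt0.
have ltP (p q : R) (m n : nat) : K * `|p - m%:R| <= 1 -> K * `|q - n%:R| <= 1 ->
    (0 < (q * t0 * s0 - p * s0 * t0) *+ 2 - s0 * t0) = (m < n)%N.
  move=> hp hq.
  have -> : (q * t0 * s0 - p * s0 * t0) *+ 2 - s0 * t0 = s0 * t0 * (2 * (q - p) - 1).
    by ring.
  rewrite pmulr_rgt0 //.
  have K16 : 16 <= K by rewrite ler_nat leq_addl.
  have hp' : `|p - m%:R| <= 8^-1 by have := normr_ge0 (p - m%:R); nra.
  have hq' : `|q - n%:R| <= 8^-1 by have := normr_ge0 (q - n%:R); nra.
  move: hp' hq'; rewrite !ler_norml => /andP[p_ge p_le] /andP[q_ge q_le].
  case: (ltnP m n) => mn.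
    have : m%:R + 1 <= n%:R :> R by rewrite natr1 ler_nat.
    by move=> ?; apply/idP; lra.
  have : n%:R <= m%:R :> R by rewrite ler_nat.
  by move=> ?; apply/negbTE; rewrite -leNgt; lra.
rewrite /= (ltP _ _ _ _ hp1 hq1) (ltP _ _ _ _ hp2 hq2) andbT /flag_adj.
congr [&& _, _ & _].
have ui := slope_lt i k0; have uj := slope_lt j k0.
move: hp1 hp2 hp3 hq1 hq2 hq3.
set a := abscissa k j in aj *; set u := slope k i in ui *; set u' := slope k j in uj *.
set v := intercept k i; set v' := intercept k j.
move=> _ hp2 hp3 hq1 hq2 hq3.
set e := (q2 - p2) * q1 + (q3 - p3).
have -> : (s0 * t0 ^+ 2) ^+ 2 - ((q2 * t0 * s0 - p2 * s0 * t0) * (q1 * t0)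
    + (q3 * t0 * s0 - p3 * s0 * t0) * t0) ^+ 2 *+ 4 =
    (s0 * t0 ^+ 2) ^+ 2 * (1 - 4 * e ^+ 2) by rewrite /e; ring.
rewrite pmulr_rgt0 ?exprn_gt0 ?mulr_gt0 //.
(* [e0] is an integer, zero exactly when the point of [j] lies on the line of [i]; the test on [e]
   is [|e| < 1/2]. *)
set e0 : R := (u' * a + v')%:R - (u * a + v)%:R.
have e_approx : `|e - e0| <= 4^-1.
  have -> : e - e0 = ((q2 - u'%:R) - (p2 - u%:R)) * q1
      + (u'%:R - u%:R) * (q1 - a%:R) + ((q3 - v'%:R) - (p3 - v%:R)).
    by rewrite /e /e0 !natrD !natrM; ring.
  have ak : a%:R <= k%:R :> R by rewrite ler_nat ltnW.
  have uk : `|u'%:R - u%:R| <= k%:R :> R.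
    rewrite ler_norml; apply/andP.
    have := ltnW ui; have := ltnW uj; rewrite -(ler_nat R) -(ler_nat R u).
    by have := ler0n R u; have := ler0n R u'; split; lra.
  have k1 : 1 <= k%:R :> R by rewrite ler1n.
  have a0 := ler0n R a.
  have q1_le : `|q1| <= k%:R + 1.
    rewrite -[q1](subrK a%:R); apply: le_trans (ler_normD _ _) _.
    rewrite (ger0_norm a0) addrC; apply: lerD => //.
    have KE : 1 <= K by rewrite ler1n addn_gt0 orbT.
    by have := normr_ge0 (q1 - a%:R); nra.
  have KE : K = 12 * k%:R + 16 by rewrite /K natrD natrM.
  rewrite -(ler_pM2l K0).
  set X1 := q2 - _; set X2 := p2 - _; set X3 := u'%:R - _; set X4 := q1 - _;
  set X5 := q3 - _; set X6 := p3 - _.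
  have T : `|(X1 - X2) * q1 + X3 * X4 + (X5 - X6)| <=
     (`|X1| + `|X2|) * (k%:R + 1) + k%:R * `|X4| + (`|X5| + `|X6|).
    apply: le_trans (ler_normD _ _) _; apply: lerD; last exact: ler_normB.
    apply: le_trans (ler_normD _ _) _; apply: lerD; rewrite normrM.
      by apply: ler_pM => //; apply: ler_normB.
    exact: ler_wpM2r.
  apply: (@le_trans _ _ (K * ((`|X1| + `|X2|) * (k%:R + 1) + k%:R * `|X4| + (`|X5| + `|X6|)))).
    by rewrite ler_pM2l.
  have -> : K * ((`|X1| + `|X2|) * (k%:R + 1) + k%:R * `|X4| + (`|X5| + `|X6|)) =
    (K * `|X1| + K * `|X2|) * (k%:R + 1) + k%:R * (K * `|X4|) + (K * `|X5| + K * `|X6|).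
    by ring.
  rewrite -/X1 -/X2 -/X4 -/X5 -/X6 in hp2 hp3 hq1 hq2 hq3.
  (* This is [3 * k + 4 = K / 4], the origin of the value of [K]. *)
  apply: (@le_trans _ _ (2 * (k%:R + 1) + k%:R * 1 + 2)); last by rewrite KE; lra.
  apply: lerD; last by lra.
  apply: lerD; last by rewrite ler_pM2l ?ltr0n.
  by rewrite ler_wpM2r; lra.
move: e_approx; rewrite ler_norml => /andP[e_ge e_le].
case: eqP => [eq0|/eqP ne].
  have e00 : e0 = 0 by rewrite /e0 eq0 subrr.
  by apply/idP; rewrite e00 in e_ge e_le; nra.
apply/negbTE; rewrite -leNgt.
move: ne; rewrite neq_ltn => /orP[] lt; move: lt; rewrite -(ler_nat R) -natr1 => lt.
  have : e0 <= -1 by rewrite /e0; lra.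
  by nra.
have : 1 <= e0 by rewrite /e0; lra.
by nra.
Qed.

From mathcomp Require Import all_classical all_reals all_analysis.
From mathcomp Require Import (canonicals, coercions) mpoly.

(** Coordinate 0, of constant weight 1, supplies the denominator of the quotients. *)
Definition flag_weights (R : pzSemiRingType) (k : nat) (c : 'I_4) (i : nat) : R :=
  nth (fun=> 1) [:: fun=> 1; fun i => (abscissa k i)%:R; fun i => (slope k i)%:R;
    fun i => (intercept k i)%:R] c i.

(** Applied to polynomial evaluation, this lets one formula describe both the polynomials and their
    values. *)
Lemma map_flag_polys (A B : comPzRingType) (g : {rmorphism A -> B})
    (s0 s1 s2 s3 t0 t1 t2 t3 : A) :
  map g (flag_polys s0 s1 s2 s3 t0 t1 t2 t3) =
    flag_polys (g s0) (g s1) (g s2) (g s3) (g t0) (g t1) (g t2) (g t3).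
Proof.
by rewrite /flag_polys /map !(rmorphD, rmorphN, rmorphM, rmorphMn, rmorphXn).
Qed.

Lemma sign_of_Pos (R : realType) (x : R) :
  (if sign_of x is Pos then true else false) = (0 < x).
Proof. by rewrite /sign_of; case: ltgtP. Qed.

(** The degree bound is uniform because only the points depend on [k] and [N]; the three polynomials
    are fixed. *)
Lemma step_up_flag_semialgebraic (R : realType) :
  exists D : nat, (0 < D)%N /\ forall k N : nat, (0 < k)%N -> (N <= 2 ^ (k ^ 4))%N ->
    semialgebraic R 4 D 3 3 (step_up (k ^ 4) (flag_adj k) N).
Proof.
pose X (j : 'I_3) (c : 'I_4) : mpoly.mpoly (3 * 4) R :=
  mpoly.mpolyX R (mpoly.mnm1 (mxvec_index j c)).
pose j0 : 'I_3 := @Ordinal 3 0 isT; pose j1 : 'I_3 := @Ordinal 3 1 isT.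
pose j2 : 'I_3 := @Ordinal 3 2 isT.
pose c0 : 'I_4 := @Ordinal 4 0 isT; pose c1 : 'I_4 := @Ordinal 4 1 isT.
pose c2 : 'I_4 := @Ordinal 4 2 isT; pose c3 : 'I_4 := @Ordinal 4 3 isT.
pose fs := flag_polys (X j1 c0 - X j0 c0) (X j1 c1 - X j0 c1)
  (X j1 c2 - X j0 c2) (X j1 c3 - X j0 c3) (X j2 c0 - X j1 c0) (X j2 c1 - X j1 c1)
  (X j2 c2 - X j1 c2) (X j2 c3 - X j1 c3).
pose f (l : 'I_3) := nth 0 fs l.
pose deg l := mpoly.mmeasure (@mpoly.mdeg _) (f l).
exists (\max_(l < 3) deg l).+1; split=> // k N k0 NM.
(* [W] bounds the differences of weights, and [B] is the least base allowed by
   [bitsum_top_bit_approx]. *)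
pose K : R := (12 * k + 16)%:R; pose W : R := (k ^ 2)%:R; pose B : R := K * W + 2.
pose p (x : 'I_#|'I_N|) : 'rV[R]_4 :=
  \row_c bitsum B (k ^ 4) (flag_weights R k c) x.
pose pos s := if s is Pos then true else false.
exists (cast_ord (card_ord N)), p, f, (fun s => [&& pos (s j0), pos (s j1) & pos (s j2)]).
split.
- by exists (cast_ord (esym (card_ord N))) => x; rewrite ?cast_ordK ?cast_ordKV.
- move=> l; rewrite /total_degree_le -/(deg l).
  by rewrite (leq_trans (leq_bigmax l)) // (leq_trans (leqnSn _)).
move=> i ihomo.
have xy : (i j0 < i j1)%N by apply: ihomo.
have yz : (i j1 < i j2)%N by apply: ihomo.
rewrite /pos !sign_of_Pos.
set v := fun l => mxvec (\matrix_(j < 3) p (i j)) 0 l.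
have evalX j c : mpoly.meval v (X j c) = bitsum B (k ^ 4) (flag_weights R k c) (i j).
  by rewrite mpoly.mevalXU /v mxvecE !mxE.
have -> : [&& 0 < eval_points (f j0) (fun j => p (i j)),
   0 < eval_points (f j1) (fun j => p (i j)) & 0 < eval_points (f j2) (fun j => p (i j))]
   = all (fun c => 0 < c) (map (mpoly.meval v) fs).
  by rewrite /= andbT.
rewrite map_flag_polys !rmorphB /= !evalX.
pose x' : 'I_N := cast_ord (card_ord N) (i j0).
pose y' : 'I_N := cast_ord (card_ord N) (i j1).
pose z' : 'I_N := cast_ord (card_ord N) (i j2).
have -> : [set cast_ord (card_ord N) (i j) | j : 'I_3]%SET = [set x'; y'; z']%SET.
  apply/setP => a; rewrite !inE; apply/imsetP/idP => [[j _ ->]|].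
    by case: j => -[|[|[|//]]] h; rewrite /x' /y' /z' ?(bool_irrelevance h isT) ?eqxx ?orbT.
  by case/orP => [/orP[]|] /eqP ->; [exists j0|exists j1|exists j2].
rewrite (@step_upE _ _ _ x' y' z' xy yz).
have zM : (i j2 < 2 ^ (k ^ 4))%N by apply: leq_trans NM; apply: (ltn_ord z').
have [d1 hd1] := top_bit_exists xy (ltn_trans yz zM).
have [d2 hd2] := top_bit_exists yz zM.
rewrite (step_up_tripleP _ (ltn_ord d1) (ltn_ord d2) hd1 hd2).
have weightW c d e : (d < k ^ 4)%N -> (e < k ^ 4)%N ->
    `|flag_weights R k c d - flag_weights R k c e| <= W.
  move=> dk ek.
  have dist m n : (m <= k ^ 2)%N -> (n <= k ^ 2)%N -> `|m%:R - n%:R| <= W.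
    rewrite -(ler_nat R) -(ler_nat R n) -/W ler_norml => hm hn.
    by apply/andP; have := ler0n R m; have := ler0n R n; split; lra.
  have kk : (k <= k ^ 2)%N by rewrite -{1}(expn1 k) leq_pexp2l.
  have ad := leq_trans (ltnW (abscissa_lt dk)) kk.
  have ae := leq_trans (ltnW (abscissa_lt ek)) kk.
  have ud := leq_trans (ltnW (slope_lt d k0)) kk.
  have ue := leq_trans (ltnW (slope_lt e k0)) kk.
  have vd := ltnW (intercept_lt d k0); have ve := ltnW (intercept_lt e k0).
  case: c => -[|[|[|[|//]]]] h; rewrite /flag_weights /=; try exact: dist.
  by rewrite subrr normr0 ler0n.
have approx d a b c : (d < k ^ 4)%N -> top_bit d a b ->
    let D c := bitsum B (k ^ 4) (flag_weights R k c) b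
             - bitsum B (k ^ 4) (flag_weights R k c) a in
    0 < D c0 /\ K * `|D c - flag_weights R k c d * D c0| <= D c0.
  move=> dk hd D; apply: (@bitsum_top_bit_approx R B W K) => //; rewrite ?ler0n //.
  by move=> e ek; apply: weightW.
have [s0 _] := approx _ _ _ c0 (ltn_ord d1) hd1.
have [t0 _] := approx _ _ _ c0 (ltn_ord d2) hd2.
apply/esym/flag_polys_gt0 => //; try exact: abscissa_lt.
- exact: (approx _ _ _ c1 (ltn_ord d1) hd1).2.
- exact: (approx _ _ _ c2 (ltn_ord d1) hd1).2.
- exact: (approx _ _ _ c3 (ltn_ord d1) hd1).2.
- exact: (approx _ _ _ c1 (ltn_ord d2) hd2).2.
- exact: (approx _ _ _ c2 (ltn_ord d2) hd2).2.
- exact: (approx _ _ _ c3 (ltn_ord d2) hd2).2.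
Qed.

(** If the Ramsey number [N] were at most [2 ^ k ^ 4], the stepped-up hypergraph on exactly [N]
    vertices would violate its defining property. *)
Lemma semialg_ramsey_gt (R : realType) :
  exists D : nat, (0 < D)%N /\ forall k n : nat, (0 < k)%N ->
    ((k ^ 4).+1 ^ (3 * k ^ 3) < n)%N -> (2 ^ k ^ 4 < semialg_ramsey R 4 D 3 3 4 n)%N.
Proof.
have [D [D0 HD]] := step_up_flag_semialgebraic R.
exists D; split=> // k n k0 kn; rewrite /semialg_ramsey.
case: ex_minnP => N /asboolP HN _; rewrite ltnNge; apply/negP => NM.
have E_lt := @flag_adj_lt k.
have [[S [S4 clS]]|[S [Sn indS]]] :=
    HN 'I_N _ (card_ord N) (@step_up_uniform _ _ N) (HD k N k0 NM).
- apply: (step_up_K4_free E_lt _ S4 clS).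
  exact: flag_adj_triangle_free.
suff : (n <= (k ^ 4).+1 ^ (3 * k ^ 3))%N by rewrite leqNgt kn.
rewrite -Sn; apply: (step_up_independent_card E_lt NM _ indS) => I.
exact: flag_independent_card.
Qed.

(** * Asymptotics *)

Import numFieldNormedType.Exports.
Local Open Scope classical_set_scope.

(** The least [k] with [n <= g k.+1] works; [k <= g k] guarantees that one exists. *)
Lemma between_values (g : nat -> nat) (n : nat) : (g 1 < n)%N ->
  (forall k, (k <= g k)%N) -> exists k, [/\ (0 < k)%N, (g k < n)%N & (n <= g k.+1)%N].
Proof.
move=> g1 gk.
have ex : exists k, (n <= g k.+1)%N by exists n; rewrite (leq_trans _ (gk n.+1)).
case: (ex_minnP ex) => -[|k] nk kmin; first by rewrite leqNgt g1 in nk.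
exists k.+1; split=> //; rewrite ltnNge; apply/negP => /kmin; rewrite ltnn //.
Qed.

Lemma ln2_ge (R : realType) : 2^-1 <= ln 2 :> R.
Proof.
rewrite -[leLHS]expRK ler_ln ?posrE ?expR_gt0 //.
rewrite -[leLHS]invrK -expRN -[leRHS]invrK lef_pV2 ?posrE ?expR_gt0 ?invr_gt0 //.
by apply: le_trans (expR_ge1Dx _); lra.
Qed.

Lemma cvgy_ln (R : realType) : ln x @[x --> +oo] --> (+oo : set_system R).
Proof.
apply/cvgryPge => A; near=> x.
have Ax : expR A <= x by near: x; exact: nbhs_pinfty_ge.
have x0 : 0 < x by apply: lt_le_trans Ax; exact: expR_gt0.
by rewrite -[A]expRK ler_ln ?posrE ?expR_gt0.
Unshelve. all: by end_near. Qed.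

Lemma cvgy_sqrt (R : realType) : Num.sqrt x @[x --> +oo] --> (+oo : set_system R).
Proof.
apply/cvgryPge => A; near=> x; apply: le_trans (ler_norm A) _.
rewrite -sqrtr_sqr ler_wsqrtr //; near: x; exact: nbhs_pinfty_ge.
Unshelve. all: by end_near. Qed.

Lemma cvgy_sqrt_ln_ln (R : realType) :
  Num.sqrt (ln (ln (n%:R : R))) @[n --> \oo] --> +oo.
Proof.
apply: (cvg_comp _ _ _ (@cvgy_sqrt R)).
by apply: (cvg_comp _ _ (cvg_comp _ _ (@cvgr_idn R) (@cvgy_ln R)) (@cvgy_ln R)).
Qed.

(** The ninth power serves to beat [s ^+ 8], which is [(ln x) ^+ 4] for [s = Num.sqrt (ln x)]. *)
Lemma expR_gt_pow9 (R : realType) (s : R) : 0 <= s ->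
  (s / 3) ^+ 9 < expR (3 * s).
Proof.
move=> s0; have -> : 3 * s = 9%:R * (s / 3) by field.
have s3 : 0 <= s / 3 by apply: divr_ge0.
have lt_s3 : s / 3 < expR (s / 3) by apply: lt_le_trans (expR_ge1Dx _); lra.
by rewrite expRM_natl (ltrXn2r 9 s3 lt_s3).
Qed.

(* To be applied to x = ln n, for the largest k with (k^4 + 1) ^ (3 k^3) < n. *)
Lemma powR_lt_pow4 (R : realType) (x : R) (k : nat) : (0 < k)%N ->
  (3 * k ^ 3)%:R * ln (k ^ 4).+1%:R < x ->
  x <= (3 * k.+1 ^ 3)%:R * ln (k.+1 ^ 4).+1%:R ->
  let s := Num.sqrt (ln x) in
  8 * 240 ^+ 4 * 3 ^+ 9 < s ->
  x `^ (3^-1 - s^-1) * x < (k ^ 4)%:R * ln 2.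
Proof.
move=> k0 xk xK s sC; set y := ln x.
have k2 : (k.+1 <= 2 * k)%N by rewrite mul2n -addnn -(addn1 k) leq_add2l.
have k1 : 1 <= k%:R :> R by rewrite ler1n.
have kn0 : 0 < k%:R :> R by rewrite ltr0n.
have s0 : 0 < s.
  apply: le_lt_trans sC; apply: mulr_ge0 (exprn_ge0 9 (ler0n _ 3)).
  exact: mulr_ge0 (ler0n _ 8) (exprn_ge0 4 (ler0n _ 240)).
have y0 : 0 < y by rewrite -sqrtr_gt0.
have sy : s ^+ 2 = y by rewrite sqr_sqrtr // ltW.
have x_gt : k%:R ^+ 3 * (3 / 2) < x.
  apply: le_lt_trans xk.
  have -> : k%:R ^+ 3 * (3 / 2) = (3 * k ^ 3)%:R * 2^-1 :> R by rewrite natrM natrX; field.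
  rewrite ler_pM2l; last by rewrite ltr0n muln_gt0 expn_gt0 k0.
  have : ln 2 <= ln (k ^ 4).+1%:R :> R by rewrite ler_ln ?posrE // ler_nat ltnS expn_gt0 k0.
  by have := ln2_ge R; lra.
have x0 : 0 < x by apply: lt_trans x_gt; rewrite mulr_gt0 ?exprn_gt0 //; lra.
have Kx : k.+1%:R <= x ^+ 2.
  rewrite -natr1.
  have : k%:R <= k%:R ^+ 3 :> R by rewrite -natrX ler_nat -{1}(expn1 k) leq_pexp2l.
  by nra.
have ln_le : ln (k.+1 ^ 4).+1%:R <= 10 * y.
  have -> : 10 * y = ln ((x ^+ 2) ^+ 5) by rewrite -exprM lnXn // mulr_natl.
  rewrite ler_ln ?posrE ?exprn_gt0 //.
  apply: (@le_trans _ _ (k.+1%:R ^+ 5)); last by rewrite lerXn2r ?nnegrE ?ler0n ?sqr_ge0.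
  rewrite -natrX ler_nat [in leqRHS]expnS mulSn -addn1 leq_add2l.
  by rewrite muln_gt0 k0 expn_gt0.
(* Here [240 = 24 * 10], from [k.+1 <= 2 * k] and [ln_le]. *)
have xle : x <= 240 * (k%:R ^+ 3 * y).
  apply: le_trans xK _.
  have -> : 240 * (k%:R ^+ 3 * y) = 24 * k%:R ^+ 3 * (10 * y) by ring.
  apply: ler_pM => //; first by rewrite ln_ge0 // ler1n.
  have -> : 24 * k%:R ^+ 3 = (3 * (2 * k) ^ 3)%:R :> R.
    by rewrite natrM natrX natrM exprMn; ring.
  by rewrite ler_nat leq_mul2l leq_exp2r.
have -> : x `^ (3^-1 - s^-1) * x = expR ((4 / 3) * y - s).
  have sys : s^-1 * y = s by rewrite -sy expr2 mulKf ?gt_eqF.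
  rewrite -{2}(lnK x0) /powR gt_eqF // -expRD -/y; congr expR.
  by rewrite mulrBl sys; lra.
have k4 : 0 <= (k ^ 4)%:R * ln 2 :> R by rewrite mulr_ge0 // ln_ge0 // ler1n.
(* Cubing clears the exponent [4 / 3]; after [xle], both sides carry the factor [k ^ 12]. *)
rewrite -(ltr_pXn2r (ltn0Sn 2)) ?nnegrE ?expR_ge0 //.
rewrite -expRM_natl.
have -> : 3%:R * (4 / 3 * y - s) = 4%:R * y - 3 * s by field.
rewrite expRB expRM_natl (lnK x0) ltr_pdivrMr ?expR_gt0 //.
apply: (@le_lt_trans _ _ ((240 * (k%:R ^+ 3 * y)) ^+ 4)).
  have y_ge0 : 0 <= 240 * (k%:R ^+ 3 * y).
    exact: mulr_ge0 (ler0n _ 240) (mulr_ge0 (exprn_ge0 3 (ler0n _ k)) (ltW y0)).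
  by rewrite lerXn2r // nnegrE ltW.
apply: (@lt_le_trans _ _ (((k ^ 4)%:R * 2^-1) ^+ 3 * expR (3 * s))); last first.
  rewrite ler_pM2r ?expR_gt0 // lerXn2r ?nnegrE ?mulr_ge0 ?invr_ge0 // ?ln_ge0 ?ler1n //.
  by rewrite ler_pM2l ?ltr0n ?expn_gt0 ?k0 // ln2_ge.
(* What remains is [8 * 240 ^+ 4 * s ^+ 8 < (s / 3) ^+ 9], which is the assumed lower bound on
   [s]. *)
have -> : (240 * (k%:R ^+ 3 * y)) ^+ 4 = ((k ^ 4)%:R * 2^-1) ^+ 3 * (8 * 240 ^+ 4 * s ^+ 8).
  by rewrite -sy natrX; set A := 240; field.
rewrite ltr_pM2l; last by rewrite exprn_gt0 // mulr_gt0 ?invr_gt0 // ltr0n expn_gt0 k0.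
apply: lt_trans (expR_gt_pow9 (ltW s0)).
rewrite expr_div_n ltr_pdivlMr ?exprn_gt0 // [ltRHS]exprSr mulrAC [_ * s ^+ 8]mulrC.
by rewrite ltr_pM2l ?exprn_gt0.
Qed.

Theorem theorem1 (R : realType) :
  exists d D m : nat,
    [/\ (0 < d)%N, (0 < D)%N & (0 < m)%N] /\
    exists o : nat -> R,
      o n @[n --> \oo] --> (0 : R) /\
      \forall n \near \oo,
        n%:R `^ (ln n%:R `^ (3^-1 - o n))
          < (semialg_ramsey R d D m 3 4 n)%:R :> R.
Proof.
have [D [D0 HD]] := semialg_ramsey_gt R.
pose s n : R := Num.sqrt (ln (ln n%:R)).
(* With this choice [(ln n) ^ (- o n)] equals [exp (- s n)], small enough to absorb the powers of
   [ln (ln n)] lost in the estimates. *)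
exists 4, D, 3; split=> //; exists (fun n => (s n)^-1).
have sy : s n @[n --> \oo] --> +oo := @cvgy_sqrt_ln_ln R.
split.
  by apply/gtr0_cvgV0 => //; apply: cvgry_gt.
near=> n.
(* 8 is the value of [(k ^ 4).+1 ^ (3 * k ^ 3)] at [k = 1]. *)
have n8 : (8 < n)%N by near: n; exact: nbhs_infty_gt.
have sC : 8 * 240 ^+ 4 * 3 ^+ 9 < s n by near: n; exact: cvgry_gt.
have [//|k|k [k0 kn nk]] := @between_values (fun k => (k ^ 4).+1 ^ (3 * k ^ 3))%N n.
  case: k => // k; apply: (@leq_trans (2 ^ k.+1)); first by rewrite ltnW // ltn_expl.
  apply: (@leq_trans ((k.+1 ^ 4).+1 ^ k.+1)).
    by rewrite leq_exp2r // ltnS expn_gt0.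
  rewrite leq_pexp2l // -{1}(expn1 k.+1).
  by apply: leq_trans (leq_pmull _ _) => //; rewrite leq_pexp2l.
have n0 : 0 < n%:R :> R by rewrite ltr0n (leq_trans _ n8).
apply: (@lt_trans _ _ (2 ^ k ^ 4)%:R); last by rewrite ltr_nat HD.
have powRE e : n%:R `^ e = expR (e * ln n%:R) :> R by rewrite /powR gt_eqF.
(* Taking logarithms leaves the inequality of [powR_lt_pow4] at [x = ln n]. *)
rewrite powRE natrX -[_ ^+ _]lnK ?posrE ?exprn_gt0 // ltr_expR lnXn // -[ln 2 *+ _]mulr_natl.
have lnXE m j : (0 < m)%N -> j%:R * ln m%:R = ln (m ^ j)%:R :> R.
  by move=> m0; rewrite natrX lnXn ?ltr0n // mulr_natl.
have posX m j : (m.+1 ^ j)%:R \is @Num.pos R by rewrite posrE ltr0n expn_gt0.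
apply: (powR_lt_pow4 k0 _ _ sC).
  by rewrite (lnXE _ _ (ltn0Sn _)) (ltr_ln (posX _ _) n0) ltr_nat.
by rewrite (lnXE _ _ (ltn0Sn _)) (ler_ln n0 (posX _ _)) ler_nat.
Unshelve. all: by end_near. Qed.
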